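(* Let $d:\mathbb{X}\to\mathbb{R}^n$ be the unknown function, and let every agent $i\in\mathcal V=\{1,\dots,N\}$ run a Gaussian process model built on its own data set $\mathbb{D}_i(t)$, where the data assumption and the kernel/RKHS assumption of the context hold. For each agent $i\in\mathcal V$ let the aggregated prediction be $$\hat d_i(t)=\sum_{j\in\{i\}\cup\mathcal N_i}\omega_{i,j}(t)\,\mu_j(k_j(t)),\qquad \omega_{i,j}(t)=\frac{\omega_{i,j}^*\,\rho_{i,j}(t)\,\eta_{i,j}^{-2}(t)}{\sum_{s\in\{i\}\cup\mathcal N_i}\omega_{i,s}^*\,\rho_{i,s}(t)\,\eta_{i,s}^{-2}(t)},$$ where $\omega_{i,j}^*\ge 0$ are pre-defined constants, and $\eta_{i,j}$, $\rho_{i,j}$, $\mu_j(k_j(t))$ are as in the context (the weights being well defined, i.e. the denominator is nonzero). Then for every $i\in\mathcal V$ and every $t\ge 0$, $$\|d(x_i(t))-\hat d_i(t)\|\le\tilde\eta_i(t)=\omega_i^*\Big(\sum_{j\in\{i\}\cup\mathcal N_i}\omega_{i,j}^*\,\rho_{i,j}(t)\,\eta_{i,j}^{-2}(t)\Big)^{-1/2},\qquad \omega_i^*=\Big(\sum_{j\in\{i\}\cup\mathcal N_i}\omega_{i,j}^*\Big)^{1/2}.$$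
   Context: **Agents.** There are $N\ge1$ agents $\mathcal V=\{1,\dots,N\}$ communicating over an undirected graph; $\mathcal N_i$ is the set of neighbors of agent $i$. Agent $i$ has state $x_i(t)=[q_i(t)^T,\dot q_i(t)^T]^T\in\mathbb X\subset\mathbb R^{2n}$, $t\ge0$, governed by $M(q_i)\ddot q_i+C(x_i)\dot q_i+g(q_i)=\tau_i+d(x_i)$ with control input $\tau_i(t)\in\mathbb R^n$, known $M,C,g$, and an unknown continuous $d=[d_1,\dots,d_n]^T:\mathbb X\to\mathbb R^n$ common to all agents. $\|\cdot\|$ is the Euclidean norm. **Time instances and data.** For each agent, $t_{i,0}=0$, $t_{i,k+1}=t_{i,k}+\Delta_i(t_{i,k})$, where $\Delta_i(t_{i,k})>0$ is the computation time of the learning step started at $t_{i,k}$; the sequence $(t_{i,k})_k$ is unbounded. Let $\bar k_i(t)$ be the largest $k$ with $t_{i,k}+\Delta_i(t_{i,k})\le t$ and $\underline k_i(t)=\max\{0,\bar k_i(t)-\bar N+1\}$, with $\bar N\in\mathbb N$, $\bar N\ge1$ fixed. The data set is $\mathbb D_i(t)=\{(x_i(t_{i,k}),y_i(t_{i,k}))\}_{k=\underline k_i(t),\dots,\bar k_i(t)}$, so $|\mathbb D_i(t)|\le\bar N$; it is empty if no $k$ satisfies $t_{i,k}+\Delta_i(t_{i,k})\le t$. The index $k_j(t)$ is that of the most recent available prediction of agent $j$: $k_j(t)=\bar k_j(t)$ (and $k_j(t)=0$ if no computation has been completed yet). **Data assumption.** $y_i(t_{i,k})=d(x_i(t_{i,k}))+w_i(t_{i,k})$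 with i.i.d. noise $w_i=[w_{i,1},\dots,w_{i,n}]^T$ satisfying $|w_{i,p}(t_{i,k})|\le\bar w_p$ for all $p=1,\dots,n$, with known $\bar w_p>0$. The pair is available only on agent $i$. **Kernel/RKHS assumption.** For each $p=1,\dots,n$, $\kappa_p:\mathbb X\times\mathbb X\to[0,\infty)$ is a stationary (positive semidefinite) kernel with $|\kappa_p(x_1,x)-\kappa_p(x_2,x)|\le L_{\kappa,p}\|x_1-x_2\|$ for all $x_1,x_2,x\in\mathbb X$, and $d_p$ belongs to the reproducing kernel Hilbert space of $\kappa_p$ with RKHS norm $\|d_p\|_{\kappa_p}\le\bar d_p$. **GP posterior.** For a data set $\mathbb D=\{(x^{(l)},y^{(l)})\}_{l=1}^m$, let $\kappa_p(x,\mathbb D)=[\kappa_p(x,x^{(1)}),\dots,\kappa_p(x,x^{(m)})]^T$, $\bar K_p(\mathbb D)=[\kappa_p(x^{(k)},x^{(l)})]_{k,l}+\bar w_p^2I_m$, $\zeta_p(\mathbb D)=[y^{(1)}_p,\dots,y^{(m)}_p]^T$ and $$\mu_p(x,\mathbb D)=\kappa_p(x,\mathbb D)^T\bar K_p(\mathbb D)^{-1}\zeta_p(\mathbb D),\quad \sigma_p^2(x,\mathbb D)=\sigma_{s,p}^2-\kappa_p(x,\mathbb D)^T\bar K_p(\mathbb D)^{-1}\kappa_p(x,\mathbb D),$$ where $\sigma_{s,p}^2=\kappa_p(x,x)$ is constant by stationarity; for $\mathbb D=\emptyset$, $\mu_p=0$ and $\sigma_p^2=\sigma_{s,p}^2$.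 Put $\mu=[\mu_1,\dots,\mu_n]^T$ and $\sigma(x,\mathbb D)=\|[\sigma_1(x,\mathbb D),\dots,\sigma_n(x,\mathbb D)]^T\|$. Write $\mu_j(k)=\mu(x_j(t_{j,k}),\mathbb D_j(t_{j,k}))$ and $\sigma_j(k)=\sigma(x_j(t_{j,k}),\mathbb D_j(t_{j,k}))$. **Constants and bounds.** $\beta=\big(\sum_{p=1}^n(\bar d_p^2+\bar N)\big)^{1/2}$, $L_d=\big(2\sum_{p=1}^n\bar d_p^2L_{\kappa,p}\big)^{1/2}$, $\sigma_s=(\sum_{p=1}^n\sigma_{s,p}^2)^{1/2}$, $$\eta_{i,j}(t)=\beta\,\sigma_j(k_j(t))+L_d\,\|x_i(t)-x_j(t_{j,k_j(t)})\|^{1/2},\qquad \rho_{i,j}(t)=\gamma(\beta\sigma_s-\eta_{i,j}(t)),$$ where $\gamma:\mathbb R\to\{0,1\}$ is the Heaviside step function ($\gamma(s)=1$ for $s>0$, $\gamma(s)=0$ for $s<0$, $\gamma(0)\in\{0,1\}$ fixed). *)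

(* Defs.v *)
From HB Require Import structures.
From mathcomp Require Import all_boot all_order all_algebra.
From mathcomp Require Import all_classical all_reals all_analysis.

Set Implicit Arguments.
Unset Strict Implicit.
Unset Printing Implicit Defensive.

Import Order.TTheory GRing.Theory Num.Theory.
Import numFieldNormedType.Exports.

Local Open Scope classical_set_scope.
Local Open Scope ring_scope.

(* MathComp-Analysis' norm `|v| on matrices is the maximum norm. *)
Definition enorm (R : realType) (m : nat) (v : 'cV[R]_m) : R :=
  Num.sqrt (\sum_(p < m) v p ord0 ^+ 2).

(* The value at 0 is a parameter. *)
Definition heaviside (R : realType) (b0 : bool) (s : R) : R :=
  if 0 < s then 1 else if s < 0 then 0 else b0%:R.

Section Kernels.
Variable R : realType.

Definition restrict2 (T : Type) (X : set T) (k : T -> T -> R) : X -> X -> R :=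
  fun a b => k (val a) (val b).

Definition psd_kernel (T : Type) (k : T -> T -> R) : Prop :=
  (forall a b, k a b = k b a) /\
  forall (m : nat) (a : 'I_m -> T) (c : 'I_m -> R),
    0 <= \sum_(i < m) \sum_(j < m) c i * c j * k (a i) (a j).

Definition stationary_on (V : zmodType) (X : set V) (k : V -> V -> R) : Prop :=
  exists phi : V -> R, forall a b, X a -> X b -> k a b = phi (a - b).

(* A reproducing kernel Hilbert space with kernel k: a Hilbert space of
   functions T -> R containing every k(., a) and such that f(a) = <f, k(., a)>.
   It is determined by k (Moore-Aronszajn).  The inner product is only
   meaningful on the carrier. *)
Record rkhs (T : Type) (k : T -> T -> R) := Rkhs {
  rk_space : set (T -> R);
  rk_ip : (T -> R) -> (T -> R) -> R;
  rk_space0 : rk_space (fun=> 0);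
  rk_spaceP : forall (c : R) f g, rk_space f -> rk_space g ->
    rk_space (fun a => c * f a + g a);
  rk_ipC : forall f g, rk_space f -> rk_space g -> rk_ip f g = rk_ip g f;
  rk_ipP : forall (c : R) f g h, rk_space f -> rk_space g -> rk_space h ->
    rk_ip (fun a => c * f a + g a) h = c * rk_ip f h + rk_ip g h;
  rk_ip_ge0 : forall f, rk_space f -> 0 <= rk_ip f f;
  rk_ip_eq0 : forall f, rk_space f -> rk_ip f f = 0 -> f = (fun=> 0);
  rk_complete : forall u : nat -> T -> R, (forall m, rk_space (u m)) ->
    let dist f g := Num.sqrt (rk_ip (fun a => f a - g a) (fun a => f a - g a)) in
    (forall e : R, 0 < e -> exists m0, forall m1 m2,
       (m0 <= m1)%N -> (m0 <= m2)%N -> dist (u m1) (u m2) < e) ->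
    exists2 f, rk_space f & forall e : R, 0 < e ->
      exists m0, forall m, (m0 <= m)%N -> dist (u m) f < e;
  rk_kernel : forall a, rk_space (k^~ a);
  rk_repr : forall f a, rk_space f -> f a = rk_ip f (k^~ a) }.

Definition rk_norm (T : Type) (k : T -> T -> R) (H : rkhs k) (f : T -> R) : R :=
  Num.sqrt (rk_ip H f f).

End Kernels.

Section GaussianProcess.
Variables (R : realType) (T : Type) (n : nat).
Variables (kappa : 'I_n -> T -> T -> R) (wbar : 'I_n -> R).

Definition kvec (p : 'I_n) (a : T) (D : seq (T * 'cV[R]_n)) : 'cV[R]_(size D) :=
  \col_l kappa p a (tnth (in_tuple D) l).1.

Definition Kbar (p : 'I_n) (D : seq (T * 'cV[R]_n)) : 'M[R]_(size D) :=
  \matrix_(k, l) kappa p (tnth (in_tuple D) k).1 (tnth (in_tuple D) l).1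
    + (wbar p ^+ 2)%:M.

Definition zeta (p : 'I_n) (D : seq (T * 'cV[R]_n)) : 'cV[R]_(size D) :=
  \col_l (tnth (in_tuple D) l).2 p ord0.

Definition gp_mean (a : T) (D : seq (T * 'cV[R]_n)) : 'cV[R]_n :=
  \col_p ((kvec p a D)^T *m invmx (Kbar p D) *m zeta p D) ord0 ord0.

Definition gp_var (p : 'I_n) (a : T) (D : seq (T * 'cV[R]_n)) : R :=
  kappa p a a - ((kvec p a D)^T *m invmx (Kbar p D) *m kvec p a D) ord0 ord0.

Definition gp_sigma (a : T) (D : seq (T * 'cV[R]_n)) : R :=
  enorm (\col_(p < n) Num.sqrt (gp_var p a D)).

End GaussianProcess.

Section OnlineData.
Variables (R : realType) (T : Type) (n : nat).

Definition sample_time (Delta : R -> R) (k : nat) : R :=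
  iter k (fun s => s + Delta s) 0.

(* The largest k with t_k + Delta(t_k) <= t, or None if there is no such k. *)
Definition last_completed (Delta : R -> R) (t : R) : option nat :=
  let done k := sample_time Delta k + Delta (sample_time Delta k) <= t in
  xget None [set Some k | k in [set k | done k /\
                                        forall l, done l -> (l <= k)%N]].

Definition latest (Delta : R -> R) (t : R) : nat :=
  odflt 0%N (last_completed Delta t).

(* In nat, kb.+1 - Nbar is max(0, kb - Nbar + 1). *)
Definition dataset (Nbar : nat) (x : R -> T) (Delta : R -> R)
    (y : nat -> 'cV[R]_n) (t : R) : seq (T * 'cV[R]_n) :=
  if last_completed Delta t is Some kb then
    [seq (x (sample_time Delta k), y k) | k <- index_iota (kb.+1 - Nbar) kb.+1]
  else [::].

Variables (kappa : 'I_n -> T -> T -> R) (wbar : 'I_n -> R).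

Definition mu_at (Nbar : nat) (x : R -> T) (Delta : R -> R)
    (y : nat -> 'cV[R]_n) (k : nat) : 'cV[R]_n :=
  let s := sample_time Delta k in
  gp_mean kappa wbar (x s) (dataset Nbar x Delta y s).

Definition sigma_at (Nbar : nat) (x : R -> T) (Delta : R -> R)
    (y : nat -> 'cV[R]_n) (k : nat) : R :=
  let s := sample_time Delta k in
  gp_sigma kappa wbar (x s) (dataset Nbar x Delta y s).

End OnlineData.

(* The set {i} U N_i for the graph with adjacency relation e. *)
Definition cl_nbhd (N : nat) (e : rel 'I_N) (i : 'I_N) : pred 'I_N :=
  fun j => (j == i) || e i j.

Definition gp_beta (R : realType) (n Nbar : nat) (dbar : 'I_n -> R) : R :=
  Num.sqrt (\sum_(p < n) (dbar p ^+ 2 + Nbar%:R)).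

Definition gp_Ld (R : realType) (n : nat) (dbar Lk : 'I_n -> R) : R :=
  Num.sqrt (2 * \sum_(p < n) dbar p ^+ 2 * Lk p).

(* x = (q, q') solves M(q) q'' + C(x) q' + g(q) = tau + d(x) on [0, +oo[.
   The input tau may jump, so q'' and the equation are only required at
   almost every time. *)
Definition trajectory (R : realType) (n : nat)
    (M : 'cV[R]_n -> 'M[R]_n) (C : 'cV[R]_(n + n) -> 'M[R]_n)
    (g : 'cV[R]_n -> 'cV[R]_n) (d : 'cV[R]_(n + n) -> 'cV[R]_n)
    (tau : R -> 'cV[R]_n) (x : R -> 'cV[R]_(n + n)) : Prop :=
  let q t := usubmx (x t) in
  let v t := dsubmx (x t) in
  [/\ {within [set t : R | 0 <= t], continuous x},
      forall (t : R) (p : 'I_n), 0 < t ->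
        is_derive t 1 (fun s : R => q s p ord0) (v t p ord0) &
      {ae (@lebesgue_measure R), forall t : R, 0 < t ->
        exists2 a : 'cV[R]_n,
          forall p : 'I_n, is_derive t 1 (fun s : R => v s p ord0) (a p ord0) &
          M (q t) *m a + C (x t) *m v t + g (q t) = tau t + d (x t)}].

Section IID.
Context (R : realType) (disp : measure_display) (Omega : measurableType disp).
Variables (P : probability Omega R) (m : nat).

Definition borel_cV : set (set 'cV[R]_m) := <<s [set B | open B] >>.

Definition iid (W : nat -> Omega -> 'cV[R]_m) : Prop :=
  [/\ forall k B, borel_cV B -> measurable (W k @^-1` B),
      forall (J : seq nat) (B : nat -> set 'cV[R]_m), uniq J ->
        (forall k, borel_cV (B k)) ->
        P (\big[setI/setT]_(k <- J) (W k @^-1` B k)) =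
        (\prod_(k <- J) fine (P (W k @^-1` B k)))%:E &
      forall k l B, borel_cV B -> P (W k @^-1` B) = P (W l @^-1` B)].

End IID.

(* Main.v *)
(** By the reproducing property and Cauchy-Schwarz in the RKHS, d_p(a) differs
    from a weighted sum of its values at the data points by at most
    |d_p| times the norm of the kernel residual, while the bounded noise
    contributes at most sqrt(m) * wbar_p * |c|, where m is the number of data
    points and c = Kbar^-1 kvec.  The squared residual norm plus
    wbar_p^2 |c|^2 is exactly the posterior variance, so
    |d - mu_j| <= beta * sigma_j at the point where mu_j is computed, and the
    RKHS modulus of continuity transfers this to x_i(t), giving
    |d(x_i(t)) - mu_j| <= eta_j.  Since the weights omega_j sum to 1, convexity
    of the squared norm bounds the squared error by
    \sum_j omega_j eta_j^2 <= (\sum_j ws_j) / S. *)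

Require Import Defs.
From HB Require Import structures.
From mathcomp Require Import all_boot all_order all_algebra.
From mathcomp Require Import all_classical all_reals all_analysis.
From mathcomp Require Import ring lra zify.

Set Implicit Arguments.
Unset Strict Implicit.
Unset Printing Implicit Defensive.

Import Order.TTheory GRing.Theory Num.Theory.
Import numFieldNormedType.Exports.

Local Open Scope classical_set_scope.
Local Open Scope ring_scope.

(** * Quadratic forms and Cauchy-Schwarz inequalities *)

Lemma discriminant_le0 (R : realFieldType) (a b c : R) : 0 <= a ->
  (forall s, 0 <= s ^+ 2 * a + 2 * s * b + c) -> b ^+ 2 <= a * c.
Proof.
rewrite le_eqVlt => /predU1P[<-|a0] h; last first.
  (* The quadratic is evaluated at its minimiser. *)
  have := h (- b / a).
  have -> : (- b / a) ^+ 2 * a + 2 * (- b / a) * b + c = (a * c - b ^+ 2) / a.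
    by field; exact: lt0r_neq0.
  by rewrite pmulr_lge0 ?invr_gt0// subr_ge0.
have [->|b0] := eqVneq b 0; first by rewrite expr0n mul0r.
(* With [a = 0] the expression is affine in [s] with slope [2 * b]; this point is where it would
   equal -1. *)
have := h (- (c + 1) / (2 * b)).
have -> : (- (c + 1) / (2 * b)) ^+ 2 * 0 + 2 * (- (c + 1) / (2 * b)) * b + c
    = -1 by field; rewrite b0.
by rewrite ler0N1.
Qed.

Lemma sum_cauchy_schwarz (R : realFieldType) (I : finType) (P : pred I)
    (a b : I -> R) :
  (\sum_(i | P i) a i * b i) ^+ 2 <=
  (\sum_(i | P i) a i ^+ 2) * \sum_(i | P i) b i ^+ 2.
Proof.
apply: discriminant_le0; first by apply: sumr_ge0 => i _; exact: sqr_ge0.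
move=> s; rewrite !mulr_sumr -!big_split /=.
by apply: sumr_ge0 => i _; have := sqr_ge0 (s * a i + b i); lra.
Qed.

Lemma sum_mul_le (R : numDomainType) (I : finType) (a b : I -> R) :
  (forall i, 0 <= a i) -> (forall i, 0 <= b i) ->
  \sum_i a i * b i <= (\sum_i a i) * \sum_i b i.
Proof.
move=> a0 b0; rewrite mulr_suml; apply: ler_sum => i _.
apply: ler_wpM2l => //; rewrite (bigD1 i) //= lerDl.
by apply: sumr_ge0.
Qed.

(** * Triangle inequality and convexity for the Euclidean norm *)

Section EuclideanNorm.
Variables (R : realType) (m : nat).
Implicit Types u v : 'cV[R]_m.

Lemma sqr_enorm v : enorm v ^+ 2 = \sum_(p < m) v p ord0 ^+ 2.
Proof. by rewrite sqr_sqrtr //; apply: sumr_ge0 => p _; exact: sqr_ge0. Qed.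

Lemma enorm_ge0 v : 0 <= enorm v.
Proof. exact: sqrtr_ge0. Qed.

Lemma enorm_le_sqrt v (a : R) : enorm v ^+ 2 <= a -> enorm v <= Num.sqrt a.
Proof. by rewrite sqr_enorm; exact: ler_wsqrtr. Qed.

Lemma ler_enormD u v : enorm (u + v) <= enorm u + enorm v.
Proof.
have nn : 0 <= enorm u + enorm v by rewrite addr_ge0 ?enorm_ge0.
rewrite -(ler_pXn2r (n := 2)) ?nnegrE ?enorm_ge0 //.
have cs : \sum_p u p ord0 * v p ord0 <= enorm u * enorm v.
  have uv0 : 0 <= enorm u * enorm v by rewrite mulr_ge0 ?enorm_ge0.
  apply: (le_trans (ler_norm _)).
  rewrite -(ler_pXn2r (n := 2)) ?nnegrE // real_normK ?num_real //.
  rewrite exprMn !sqr_enorm; exact: sum_cauchy_schwarz.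
have -> : enorm (u + v) ^+ 2 =
    enorm u ^+ 2 + 2 * (\sum_p u p ord0 * v p ord0) + enorm v ^+ 2.
  rewrite !sqr_enorm mulr_sumr -!big_split /=.
  by apply: eq_bigr => p _; rewrite mxE; ring.
by rewrite sqrrD; lra.
Qed.

(** In each coordinate this is Cauchy-Schwarz for the families [sqrt (w i)] and
    [sqrt (w i) * v i p], the first of which has unit norm. *)
Lemma sqr_enorm_convex (I : finType) (P : pred I) (w : I -> R)
    (v : I -> 'cV[R]_m) :
  (forall i, P i -> 0 <= w i) -> \sum_(i | P i) w i = 1 ->
  enorm (\sum_(i | P i) w i *: v i) ^+ 2 <=
  \sum_(i | P i) w i * enorm (v i) ^+ 2.
Proof.
move=> w0 w1.
under [X in _ <= X]eq_bigr do rewrite sqr_enorm mulr_sumr.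
rewrite sqr_enorm exchange_big; apply: ler_sum => p _.
rewrite summxE.
have := sum_cauchy_schwarz P (fun i => Num.sqrt (w i))
  (fun i => Num.sqrt (w i) * v i p ord0).
have -> : \sum_(i | P i) Num.sqrt (w i) ^+ 2 = 1.
  by rewrite -w1; apply: eq_bigr => i /w0/sqr_sqrtr.
rewrite mul1r => h.
rewrite (eq_bigr (fun i => Num.sqrt (w i) * (Num.sqrt (w i) * v i p ord0))).
  apply: (le_trans h); rewrite le_eqVlt; apply/predU1P; left.
  by apply: eq_bigr => i /w0 wi; rewrite exprMn sqr_sqrtr.
by move=> i /w0 wi; rewrite mxE mulrA -expr2 sqr_sqrtr.
Qed.

End EuclideanNorm.

(** * Finite kernel combinations in an RKHS *)

Section ReproducingKernel.
Variables (R : realType) (T : Type) (k : T -> T -> R) (H : rkhs k).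

Lemma rkhs_kernelC a b : k a b = k b a.
Proof.
have ka := rk_kernel H a; have kb := rk_kernel H b.
by rewrite (rk_repr a kb) (rk_repr b ka) rk_ipC.
Qed.

Lemma rk_cauchy_schwarz f g : rk_space H f -> rk_space H g ->
  rk_ip H f g ^+ 2 <= rk_ip H f f * rk_ip H g g.
Proof.
move=> Hf Hg; apply: discriminant_le0; first exact: rk_ip_ge0.
move=> s; have Hh := rk_spaceP s Hf Hg.
have := rk_ip_ge0 Hh.
rewrite rk_ipP // (rk_ipC Hf Hh) (rk_ipC Hg Hh) !rk_ipP // (rk_ipC Hg Hf).
lra.
Qed.

(** The inner product is linear only on the carrier, so membership of the partial sums is carried
    through the induction together with the formula. *)
Lemma rk_comb (I : finType) (c : I -> R) (b : I -> T) (r : seq I) :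
  let h a := \sum_(i <- r) c i * k a (b i) in
  rk_space H h /\
  forall f, rk_space H f -> rk_ip H f h = \sum_(i <- r) c i * f (b i).
Proof.
elim: r => [|i r [IHs IHf]] /=.
  have -> : (fun a => \sum_(i <- [::]) c i * k a (b i)) = (fun=> 0).
    by apply/funext => a; rewrite big_nil.
  have H0 := rk_space0 H; split=> // f Hf; rewrite big_nil rk_ipC //.
  (* Linearity applied to 0 = 1 * 0 + 0 shows that the inner product of 0 with [f] equals its own
     double. *)
  have := rk_ipP 1 H0 H0 Hf.
  have -> : (fun a : T => 1 * 0 + 0) = (fun=> 0) :> (T -> R).
    by apply/funext => a; rewrite mul1r addr0.
  lra.
have -> : (fun a => \sum_(j <- i :: r) c j * k a (b j)) =
    (fun a => c i * k a (b i) + \sum_(j <- r) c j * k a (b j)).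
  by apply/funext => a; rewrite big_cons.
have Hi := rk_kernel H (b i).
have Hs := rk_spaceP (c i) Hi IHs; split=> // f Hf.
rewrite rk_ipC // (rk_ipP (c i) Hi IHs Hf) big_cons (rk_repr (b i) Hf).
by rewrite (rk_ipC Hi Hf) (rk_ipC IHs Hf) IHf.
Qed.

Lemma rkhs_gram_ge0 (I : finType) (c : I -> R) (b : I -> T) :
  0 <= \sum_i \sum_j c i * c j * k (b i) (b j).
Proof.
have [Hh hE] := rk_comb c b (index_enum I).
have := rk_ip_ge0 Hh; rewrite hE //.
by under eq_bigr do (rewrite mulr_sumr; under eq_bigr do rewrite mulrA).
Qed.

Lemma rkhs_comb_le (I : finType) (c : I -> R) (b : I -> T) (f : T -> R) :
  rk_space H f ->
  (\sum_i c i * f (b i)) ^+ 2 <=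
  rk_norm H f ^+ 2 * \sum_i \sum_j c i * c j * k (b i) (b j).
Proof.
move=> Hf; have [Hh hE] := rk_comb c b (index_enum I).
have := rk_cauchy_schwarz Hf Hh; rewrite !hE //.
rewrite sqr_sqrtr; last exact: rk_ip_ge0.
congr (_ <= _ * _); apply: eq_bigr => i _.
by rewrite mulr_sumr; apply: eq_bigr => j _; rewrite mulrA.
Qed.

(** The last factor is the squared RKHS distance between the kernel sections at [a] and [b], a
    two-term combination with weights 1 and -1. *)
Lemma rkhs_diff_le (f : T -> R) (a b : T) : rk_space H f ->
  (f a - f b) ^+ 2 <= rk_norm H f ^+ 2 * (k a a - k b a + (k b b - k a b)).
Proof.
move=> Hf; have := rkhs_comb_le (fun i : bool => if i then 1 else -1)
  (fun i => if i then a else b) Hf.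
by rewrite !big_bool /=; congr (_ ^+ 2 <= _ * _); ring.
Qed.

(** [V] is the squared norm of the kernel section at [a] minus its approximation by the sections at
    the [b l]. It becomes a single Gram sum once [a] is adjoined as index 0 with weight 1 and the
    other weights are negated. *)
Lemma rkhs_residual (m : nat) (c : 'I_m -> R) (b : 'I_m -> T) (a : T) :
  let V := k a a - 2 * (\sum_l c l * k a (b l)) +
           \sum_l \sum_l' c l * c l' * k (b l) (b l') in
  0 <= V /\ forall f, rk_space H f ->
  (f a - \sum_l c l * f (b l)) ^+ 2 <= rk_norm H f ^+ 2 * V.
Proof.
pose c' (i : 'I_m.+1) := if unlift ord0 i is Some l then - c l else 1.
pose b' (i : 'I_m.+1) := if unlift ord0 i is Some l then b l else a.
set V := (X in let V := X in _).
have VE : V = \sum_i \sum_j c' i * c' j * k (b' i) (b' j).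
  (* Splitting off index 0 in both sums leaves [k a a], two cross sums that agree by symmetry of
     [k], and the Gram sum of the [b l]. *)
  rewrite /V big_ord_recl big_ord_recl /c' /b' unlift_none.
  under [X in _ = _ + X + _]eq_bigr do rewrite liftK.
  under [X in _ = _ + X]eq_bigr => i _.
    rewrite big_ord_recl unlift_none liftK.
    under eq_bigr do rewrite liftK mulrNN.
    rewrite (rkhs_kernelC (b i) a).
    over.
  rewrite big_split /= addrA; congr (_ + _).
  rewrite -addrA -big_split /= mulr_sumr -sumrN; congr (_ + _); first by ring.
  by apply: eq_bigr => i _; ring.
split; first by rewrite VE; exact: rkhs_gram_ge0.
move=> f Hf; rewrite VE.
have -> : f a - \sum_l c l * f (b l) = \sum_i c' i * f (b' i).
  rewrite big_ord_recl /c' /b' unlift_none mul1r; congr (_ + _).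
  by rewrite -sumrN; apply: eq_bigr => i _; rewrite liftK mulNr.
exact: rkhs_comb_le.
Qed.

End ReproducingKernel.

(** * Scalar error bound for the Gaussian process posterior *)

Section PosteriorError.
Variables (R : realType) (T : Type) (X : set T) (n : nat).
Variables (kappa : 'I_n -> T -> T -> R) (wbar : 'I_n -> R) (p : 'I_n).
Hypothesis wbar_gt0 : 0 < wbar p.
Variable H : rkhs (restrict2 (X := X) (kappa p)).
Implicit Type D : seq (T * 'cV[R]_n).

Lemma Kbar_quad D (v : 'rV[R]_(size D)) :
  (v *m Kbar kappa wbar p D *m v^T) ord0 ord0 =
  \sum_l \sum_l' v ord0 l * v ord0 l' *
    kappa p (tnth (in_tuple D) l).1 (tnth (in_tuple D) l').1 +
  wbar p ^+ 2 * \sum_l v ord0 l ^+ 2.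
Proof.
rewrite /Kbar mulmxDr mulmxDl mxE; congr (_ + _); last first.
  rewrite mul_mx_scalar -scalemxAl mxE mxE; congr (_ * _).
  by apply: eq_bigr => l _; rewrite mxE expr2.
rewrite mxE exchange_big /=; apply: eq_bigr => l _.
rewrite !mxE mulr_suml; apply: eq_bigr => l' _.
by rewrite !mxE mulrAC.
Qed.

(** If [v] annihilates the matrix, its quadratic form vanishes; the Gram part is nonnegative, so the
    ridge term [wbar p ^+ 2 * |v|^2] must be 0. Invertibility makes [invmx] a genuine inverse. *)
Lemma Kbar_unitmx D : (forall l, X (tnth (in_tuple D) l).1) ->
  Kbar kappa wbar p D \in unitmx.
Proof.
move=> XD; rewrite -row_free_unit; apply: inj_row_free => v v0.
have := Kbar_quad v; rewrite v0 mul0mx mxE.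
have g0 := rkhs_gram_ge0 H (fun l => v ord0 l)
  (fun l => exist (fun z => z \in X) _ (mem_set (XD l))).
have s0 : 0 <= \sum_l v ord0 l ^+ 2.
  by apply: sumr_ge0 => l _; exact: sqr_ge0.
move=> /esym/eqP; rewrite paddr_eq0 //; last by rewrite mulr_ge0 ?sqr_ge0.
move=> /andP[_]; rewrite mulf_eq0 sqrf_eq0 gt_eqF //=.
rewrite psumr_eq0 => [|l _]; last exact: sqr_ge0.
move=> /allP h; apply/rowP => l; rewrite mxE.
by have := h l (mem_index_enum l); rewrite /= sqrf_eq0 => /eqP.
Qed.

(* With weights c = Kbar^-1 kvec, the posterior variance splits as
   |k_a - \sum_l c_l k_(x_l)|^2 + wbar^2 |c|^2, where c^T Kbar c = c^T kvec. *)
Lemma gp_posterior_error D a f (dbar : R) :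
  X a -> (forall l, X (tnth (in_tuple D) l).1) ->
  rk_space H (fun b : X => f (val b)) ->
  rk_norm H (fun b : X => f (val b)) <= dbar ->
  (forall l, `|(tnth (in_tuple D) l).2 p ord0 - f (tnth (in_tuple D) l).1|
     <= wbar p) ->
  0 <= gp_var kappa wbar p a D /\
  (f a - gp_mean kappa wbar a D p ord0) ^+ 2 <=
    (dbar ^+ 2 + (size D)%:R) * gp_var kappa wbar p a D.
Proof.
move=> Xa XD Hf fdbar wD; have Ku := Kbar_unitmx XD.
pose c := (kvec kappa p a D)^T *m invmx (Kbar kappa wbar p D).
pose b l := (tnth (in_tuple D) l).1.
pose W := \sum_l c ord0 l ^+ 2.
have W0 : 0 <= W by apply: sumr_ge0 => l _; exact: sqr_ge0.
have cK : c *m Kbar kappa wbar p D = (kvec kappa p a D)^T by rewrite mulmxKV.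
have ckE : (c *m kvec kappa p a D) ord0 ord0 =
    \sum_l c ord0 l * kappa p a (b l).
  by rewrite mxE; apply: eq_bigr => l _; rewrite [X in _ * X]mxE.
have [] := rkhs_residual H (fun l => c ord0 l)
  (fun l => exist (fun z => z \in X) _ (mem_set (XD l)))
  (exist (fun z => z \in X) _ (mem_set Xa)).
set V := (X in 0 <= X) => V0 /(_ _ Hf) /= le_V.
have varE : gp_var kappa wbar p a D = V + wbar p ^+ 2 * W.
  have := Kbar_quad c; rewrite cK.
  have -> : ((kvec kappa p a D)^T *m c^T) ord0 ord0 =
      \sum_l c ord0 l * kappa p a (b l).
    by rewrite -ckE -trmx_mul mxE.
  rewrite /gp_var -/c ckE /V /W /restrict2 /= /b; lra.
have meanE : gp_mean kappa wbar a D p ord0 =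
    \sum_l c ord0 l * (tnth (in_tuple D) l).2 p ord0.
  by rewrite mxE -/c mxE; apply: eq_bigr => l _; rewrite [X in _ * X]mxE.
rewrite varE meanE; split; first by rewrite addr_ge0 // mulr_ge0 ?sqr_ge0.
(* [A] is the error of the noise-free interpolation and [B] is the weighted noise. *)
pose A := f a - \sum_l c ord0 l * f (b l).
pose B := \sum_l c ord0 l * ((tnth (in_tuple D) l).2 p ord0 - f (b l)).
have -> : f a - \sum_l c ord0 l * (tnth (in_tuple D) l).2 p ord0 = A - B.
  have -> : B = \sum_l c ord0 l * (tnth (in_tuple D) l).2 p ord0 -
      \sum_l c ord0 l * f (b l).
    by rewrite -sumrB; apply: eq_bigr => l _; rewrite mulrBr.
  by rewrite /A; ring.
have A2 : A ^+ 2 <= dbar ^+ 2 * V.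
  apply: (le_trans le_V); apply: ler_wpM2r => //.
  have n0 : 0 <= rk_norm H (fun b : X => f (val b)) by exact: sqrtr_ge0.
  by rewrite ler_pXn2r ?nnegrE // (le_trans n0).
have B2 : B ^+ 2 <= (size D)%:R * (wbar p ^+ 2 * W).
  apply: (le_trans (sum_cauchy_schwarz _ _ _)).
  rewrite -/W mulrA mulrC; apply: ler_wpM2r => //.
  rewrite mulr_natl -[size D in leRHS]card_ord -sumr_const.
  apply: ler_sum => l _; rewrite -real_normK ?num_real //.
  by rewrite ler_pXn2r ?nnegrE ?wD // ltW.
set m := (size D)%:R in B2 *; have m0 : 0 <= m :> R by exact: ler0n.
set W' := wbar p ^+ 2 * W in B2 *.
have W'0 : 0 <= W' by rewrite mulr_ge0 ?sqr_ge0.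
(* These are the mixed terms of [(dbar ^+ 2 + m) * (V + W')]. The bounds on [A ^+ 2] and [B ^+ 2]
   control the square of the left side by four times the product of the two summands, and AM-GM
   concludes. *)
have AB : - (2 * (A * B)) <= dbar ^+ 2 * W' + m * V.
  have P0 : 0 <= dbar ^+ 2 * W' + m * V.
    by apply: addr_ge0; apply: mulr_ge0 => //; exact: sqr_ge0.
  apply: (le_trans (ler_norm _)); rewrite normrN.
  rewrite -(ler_pXn2r (n := 2)) ?nnegrE // real_normK ?num_real //.
  apply: (@le_trans _ _ (4 * ((dbar ^+ 2 * V) * (m * W')))).
    have -> : (2 * (A * B)) ^+ 2 = 4 * (A ^+ 2 * B ^+ 2) by ring.
    apply: ler_wpM2l; first by lra.
    by apply: ler_pM; rewrite ?sqr_ge0.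
  by have := sqr_ge0 (dbar ^+ 2 * W' - m * V); lra.
rewrite sqrrB; lra.
Qed.

End PosteriorError.

(** * Size and entries of the online data sets *)

Section SampleTimes.
Variables (R : realType) (T : Type) (n : nat).

Lemma sample_time_ge0 (Delta : R -> R) k :
  (forall l, 0 < Delta (sample_time Delta l)) -> 0 <= sample_time Delta k.
Proof.
by move=> D0; elim: k => //= k IHk; rewrite addr_ge0 // ltW // D0.
Qed.

Lemma size_dataset_le Nbar (x : R -> T) Delta (y : nat -> 'cV[R]_n) t :
  (size (dataset Nbar x Delta y t) <= Nbar)%N.
Proof.
rewrite /dataset; case: last_completed => //= k.
(* By truncated subtraction, the index range has min(k + 1, [Nbar]) elements. *)
by rewrite size_map size_iota leq_subLR; lia.
Qed.

Lemma tnth_dataset Nbar (x : R -> T) Delta (y : nat -> 'cV[R]_n) t l :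
  exists k, tnth (in_tuple (dataset Nbar x Delta y t)) l =
            (x (sample_time Delta k), y k).
Proof.
case: l; rewrite /dataset; case: last_completed => //= k l ltl.
exists (nth 0%N (index_iota (k.+1 - Nbar) k.+1) l).
rewrite (tnth_nth (x 0, y 0%N)) (nth_map 0%N) //.
by move: ltl; rewrite size_map.
Qed.

End SampleTimes.

(** * From componentwise bounds to vector bounds *)

Section VectorBounds.
Variables (R : realType) (m n : nat) (X : set 'cV[R]_m).
Variables (d : 'cV[R]_m -> 'cV[R]_n).
Variables (kappa : 'I_n -> 'cV[R]_m -> 'cV[R]_m -> R).
Variables (H : forall p, rkhs (restrict2 (X := X) (kappa p))).
Variable dbar : 'I_n -> R.
Hypothesis hdH : forall p, rk_space (H p) (fun a : X => d (val a) p ord0).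
Hypothesis hdbar :
  forall p, rk_norm (H p) (fun a : X => d (val a) p ord0) <= dbar p.

Lemma enorm_gp_error_le (wbar : 'I_n -> R) (D : seq ('cV[R]_m * 'cV[R]_n))
    (Nbar : nat) (a : 'cV[R]_m) :
  (forall p, 0 < wbar p) -> X a -> (size D <= Nbar)%N ->
  (forall l, X (tnth (in_tuple D) l).1) ->
  (forall l p, `|(tnth (in_tuple D) l).2 p ord0 -
                 d (tnth (in_tuple D) l).1 p ord0| <= wbar p) ->
  enorm (d a - gp_mean kappa wbar a D) <=
    gp_beta Nbar dbar * gp_sigma kappa wbar a D.
Proof.
move=> w0 Xa sD XD wD.
have err p := @gp_posterior_error _ _ _ _ kappa wbar p (w0 p) (H p) D a
  (fun b => d b p ord0) _ Xa XD (hdH p) (hdbar p) (fun l => wD l p).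
have b0 p : 0 <= dbar p ^+ 2 + Nbar%:R by rewrite addr_ge0 ?sqr_ge0 ?ler0n.
have v0 p : 0 <= gp_var kappa wbar p a D by have [] := err p.
rewrite /gp_beta /gp_sigma /enorm -sqrtrM; last by apply: sumr_ge0.
rewrite ler_sqrt; last first.
  by apply: mulr_ge0; apply: sumr_ge0 => p _ //; exact: sqr_ge0.
(* Nonnegativity of the variance is what lets the square undo the root. *)
under [X in _ <= _ * X]eq_bigr do rewrite mxE sqr_sqrtr //.
apply: le_trans (sum_mul_le b0 v0); apply: ler_sum => p _.
have [_ h] := err p.
rewrite [in leLHS]mxE [X in _ + X]mxE; apply: (le_trans h).
by apply: ler_wpM2r => //; rewrite lerD2l ler_nat.
Qed.

(** The squared RKHS distance between the two kernel sections is a sum of two kernel increments,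
    each at most [Lk p * enorm (a - b)]; hence the Hölder exponent 1/2. *)
Lemma enorm_rkhs_diff_le (Lk : 'I_n -> R) (a b : 'cV[R]_m) :
  (forall p a1 a2 c, X a1 -> X a2 -> X c ->
     `|kappa p a1 c - kappa p a2 c| <= Lk p * enorm (a1 - a2)) ->
  X a -> X b ->
  enorm (d a - d b) <= gp_Ld dbar Lk * Num.sqrt (enorm (a - b)).
Proof.
move=> kL Xa Xb.
have sym : enorm (b - a) = enorm (a - b).
  by rewrite -opprB /enorm; congr Num.sqrt; apply: eq_bigr => p _;
    rewrite !mxE sqrrN.
have kp p : (d a p ord0 - d b p ord0) ^+ 2 <=
    2 * (dbar p ^+ 2 * Lk p * enorm (a - b)).
  have := rkhs_diff_le (exist (fun z => z \in X) _ (mem_set Xa))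
    (exist (fun z => z \in X) _ (mem_set Xb)) (hdH p).
  rewrite /restrict2 /= => /le_trans; apply.
  have n0 : 0 <= rk_norm (H p) (fun a : X => d (val a) p ord0).
    exact: sqrtr_ge0.
  have n2 : rk_norm (H p) (fun a : X => d (val a) p ord0) ^+ 2 <= dbar p ^+ 2.
    by rewrite ler_pXn2r ?nnegrE // (le_trans n0).
  have ka := le_trans (ler_norm _) (kL p a b a Xa Xb Xa).
  have kb := le_trans (ler_norm _) (kL p b a b Xb Xa Xb).
  have kab := le_trans (normr_ge0 _) (kL p a b a Xa Xb Xa).
  rewrite sym in kb.
  apply: (@le_trans _ _ (rk_norm (H p) (fun a : X => d (val a) p ord0) ^+ 2 *
    (2 * (Lk p * enorm (a - b))))).
    by apply: ler_wpM2l; [exact: sqr_ge0|lra].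
  have := ler_wpM2r kab n2; lra.
have sq : enorm (d a - d b) ^+ 2 <=
    2 * (\sum_p dbar p ^+ 2 * Lk p) * enorm (a - b).
  rewrite sqr_enorm -mulrA mulr_suml mulr_sumr; apply: ler_sum => p _.
  by rewrite !mxE.
(* At distance 0, [sq] already forces a zero left side; otherwise one may divide by the distance. *)
have [e0|e0] := eqVneq (enorm (a - b)) 0.
  rewrite e0 sqrtr0 mulr0; rewrite e0 mulr0 in sq.
  by move: sq; rewrite le_eqVlt ltNge sqr_ge0 orbF sqrf_eq0 => /eqP ->.
have ep : 0 < enorm (a - b) by rewrite lt_def e0 enorm_ge0.
(* Lk p may be negative when X is a point; the sign is read off sq. *)
have L0 : 0 <= 2 * (\sum_p dbar p ^+ 2 * Lk p).
  by rewrite -(pmulr_lge0 _ ep) (le_trans _ sq) ?sqr_ge0.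
by rewrite /gp_Ld -sqrtrM //; exact: enorm_le_sqrt.
Qed.

End VectorBounds.

(** * Weighted aggregation and the distributed bound *)

Lemma heaviside_itv (R : realType) b (s : R) : 0 <= heaviside b s <= 1.
Proof.
rewrite /heaviside; case: ifP => _; first by rewrite ler01 lexx.
by case: ifP => _; [|case: b]; rewrite ?lexx ?ler01.
Qed.

Lemma enorm_aggregate_le (R : realType) (m : nat) (I : finType) (Q : pred I)
    (ws rho eta : I -> R) (z : 'cV[R]_m) (v : I -> 'cV[R]_m) :
  (forall j, Q j -> 0 <= ws j) -> (forall j, 0 <= rho j <= 1) ->
  (forall j, Q j -> enorm (z - v j) <= eta j) ->
  let S := \sum_(j | Q j) ws j * rho j * eta j ^- 2 in
  S != 0 ->
  enorm (z - \sum_(j | Q j) (ws j * rho j * eta j ^- 2 / S) *: v j) <=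
    Num.sqrt (\sum_(j | Q j) ws j) * (Num.sqrt S)^-1.
Proof.
move=> ws0 rho01 zv S Sn0.
have c0 j : Q j -> 0 <= ws j * rho j * eta j ^- 2.
  move=> Qj; have /andP[r0 _] := rho01 j.
  by rewrite !mulr_ge0 ?ws0 // invr_ge0 sqr_ge0.
have S0 : 0 < S by rewrite lt_def Sn0 sumr_ge0.
have w1 : \sum_(j | Q j) ws j * rho j * eta j ^- 2 / S = 1.
  by rewrite -mulr_suml divff.
have -> : z - \sum_(j | Q j) (ws j * rho j * eta j ^- 2 / S) *: v j =
    \sum_(j | Q j) (ws j * rho j * eta j ^- 2 / S) *: (z - v j).
  rewrite -[z in LHS]scale1r -w1 scaler_suml -sumrB.
  by apply: eq_bigr => j _; rewrite scalerBr.
rewrite -sqrtrV ?(ltW S0) // -sqrtrM; last exact: sumr_ge0.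
apply: enorm_le_sqrt.
apply: (le_trans (sqr_enorm_convex _ _ w1)) => [j Qj|].
  by rewrite mulr_ge0 ?c0 // invr_ge0 ltW.
rewrite mulr_suml; apply: ler_sum => j Qj.
rewrite mulrAC; apply: ler_wpM2r; first by rewrite invr_ge0 ltW.
have /andP[r0 r1] := rho01 j.
have eta0 : 0 <= eta j by apply: le_trans (zv j Qj); exact: enorm_ge0.
apply: (@le_trans _ _ (ws j * rho j * eta j ^- 2 * eta j ^+ 2)).
  by apply: ler_wpM2l; [exact: c0|rewrite ler_pXn2r ?nnegrE ?enorm_ge0 ?zv].
(* If [eta j] is 0 the product is 0; otherwise the powers cancel and [rho j <= 1] remains to be
   used. *)
have [->|en0] := eqVneq (eta j) 0; first by rewrite expr0n /= mulr0 ws0.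
by rewrite mulfVK ?expf_neq0 // -[leRHS]mulr1 ler_wpM2l ?ws0.
Qed.

Theorem theorem1 (R : realType) (N n Nbar : nat)
  (hN : (1 <= N)%N) (hn : (1 <= n)%N) (hNbar : (1 <= Nbar)%N)
  (* communication graph *)
  (e : rel 'I_N) (he : symmetric e)
  (* state space, unknown function and agent dynamics *)
  (X : set 'cV[R]_(n + n))
  (d : 'cV[R]_(n + n) -> 'cV[R]_n) (hd : {within X, continuous d})
  (M : 'cV[R]_n -> 'M[R]_n) (C : 'cV[R]_(n + n) -> 'M[R]_n)
  (g : 'cV[R]_n -> 'cV[R]_n)
  (* sample space of the noise *)
  (disp : measure_display) (Omega : measurableType disp)
  (P : probability Omega R)
  (tau : Omega -> 'I_N -> R -> 'cV[R]_n)
  (x : Omega -> 'I_N -> R -> 'cV[R]_(n + n))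
  (hxX : forall o i t, 0 <= t -> X (x o i t))
  (hdyn : forall o i, trajectory M C g d (tau o i) (x o i))
  (* computation times *)
  (Delta : Omega -> 'I_N -> R -> R)
  (hDelta : forall o i k, 0 < Delta o i (sample_time (Delta o i) k))
  (hunb : forall o i (B : R), exists k, B < sample_time (Delta o i) k)
  (* data assumption *)
  (wbar : 'I_n -> R) (hwbar : forall p, 0 < wbar p)
  (w y : Omega -> 'I_N -> nat -> 'cV[R]_n)
  (hiid : forall i, iid P (fun k o => w o i k))
  (hw : forall o i k p, `|w o i k p ord0| <= wbar p)
  (hy : forall o i k,
     y o i k = d (x o i (sample_time (Delta o i) k)) + w o i k)
  (* kernel / RKHS assumption *)
  (kappa : 'I_n -> 'cV[R]_(n + n) -> 'cV[R]_(n + n) -> R)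
  (hkge0 : forall p a b, X a -> X b -> 0 <= kappa p a b)
  (hkpsd : forall p, psd_kernel (restrict2 (X := X) (kappa p)))
  (hkstat : forall p, stationary_on X (kappa p))
  (Lk : 'I_n -> R)
  (hkLip : forall p a1 a2 a, X a1 -> X a2 -> X a ->
     `|kappa p a1 a - kappa p a2 a| <= Lk p * enorm (a1 - a2))
  (H : forall p, rkhs (restrict2 (X := X) (kappa p)))
  (dbar : 'I_n -> R)
  (hdH : forall p, rk_space (H p) (fun a : X => d (val a) p ord0))
  (hdbar : forall p, rk_norm (H p) (fun a : X => d (val a) p ord0) <= dbar p)
  (sigs2 : 'I_n -> R) (hsigs2 : forall p a, X a -> kappa p a a = sigs2 p)
  (* Heaviside convention at 0 and pre-defined weights *)
  (gamma0 : bool)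
  (ws : 'I_N -> 'I_N -> R)
  (hws : forall i j, cl_nbhd e i j -> 0 <= ws i j) :
  forall (o : Omega) (i : 'I_N) (t : R), 0 <= t ->
  let beta := gp_beta Nbar dbar in
  let sigma_s := Num.sqrt (\sum_(p < n) sigs2 p) in
  let k j := latest (Delta o j) t in
  let mu j := mu_at kappa wbar Nbar (x o j) (Delta o j) (y o j) (k j) in
  let sigma j := sigma_at kappa wbar Nbar (x o j) (Delta o j) (y o j) (k j) in
  let eta j := beta * sigma j + gp_Ld dbar Lk *
    Num.sqrt (enorm (x o i t - x o j (sample_time (Delta o j) (k j)))) in
  let rho j := heaviside gamma0 (beta * sigma_s - eta j) in
  let S := \sum_(j < N | cl_nbhd e i j) ws i j * rho j * eta j ^- 2 in
  let omega j := ws i j * rho j * eta j ^- 2 / S in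
  let dhat := \sum_(j < N | cl_nbhd e i j) omega j *: mu j in
  let omega_star := Num.sqrt (\sum_(j < N | cl_nbhd e i j) ws i j) in
  S != 0 ->
  enorm (d (x o i t) - dhat) <= omega_star * (Num.sqrt S)^-1.
Proof.
move=> o i t t0 beta sigma_s k mu sigma eta rho S omega dhat omega_star Sn0.
apply: enorm_aggregate_le => // [j nij|j|j nij]; first exact: hws.
  exact: heaviside_itv.
have s0 l l' : 0 <= sample_time (Delta o l) l'.
  exact: sample_time_ge0.
have Xs l l' : X (x o l (sample_time (Delta o l) l')) by exact: hxX.
(* The error is split at the state of agent [j] at time [s], where [mu j] was computed: the first
   part yields the [beta * sigma j] term, the second the [gp_Ld] term. *)
set s := sample_time (Delta o j) (k j).
have -> : d (x o i t) - mu j =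
    (d (x o j s) - mu j) + (d (x o i t) - d (x o j s)).
  by rewrite [RHS]addrC addrA subrK.
apply: (le_trans (ler_enormD _ _)); apply: lerD; last first.
  by apply: (enorm_rkhs_diff_le hdH hdbar hkLip); [exact: hxX|exact: Xs].
apply: (enorm_gp_error_le hdH hdbar hwbar) => [||l|l p].
- exact: Xs.
- exact: size_dataset_le.
- by have [l' ->] := tnth_dataset l; exact: Xs.
- by have [l' ->] := tnth_dataset l; rewrite /= hy mxE addrAC subrr add0r.
Qed.
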